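(* Let $I=(I_-,I_+)\subset\mathbb R$ be a nonempty open interval with closure $\overline I=[I_-,I_+]\subset[-\infty,\infty]$, and let $\lambda_\pm:\overline I\to[0,\infty)$ be continuous functions such that $\lambda_-$ is nonincreasing, $\lambda_+$ is nondecreasing, $\lambda_+(I_-)>0$ and $\lambda_-(I_+)>0$. Then Luckock's equation has a unique solution $(f_-,f_+)$. One has $$\text{(i)}\quad f_-(I_-)\ge0\ \Leftrightarrow\ \Lambda_-:=\frac{1}{\lambda_-(I_-)\lambda_-(I_+)}-\int_{I_-}^{I_+}\frac{1}{\lambda_+}\,\mathrm d\Big(\frac1{\lambda_-}\Big)\ge0,$$ $$\text{(ii)}\quad f_+(I_+)\ge0\ \Leftrightarrow\ \Lambda_+:=\frac{1}{\lambda_+(I_-)\lambda_+(I_+)}+\int_{I_-}^{I_+}\frac{1}{\lambda_-}\,\mathrm d\Big(\frac1{\lambda_+}\Big)\ge0.$$ Both equivalences also hold with the inequality signs reversed (i.e. with both $\ge$ replaced by $\le$). The functions $(f_-,f_+)$ also satisfy $$\lambda_+(I_+)-f_-(I_-)\lambda_+(I_-)=\lambda_-(I_-)-f_+(I_+)\lambda_-(I_+).$$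
   Context: If $f:\overline I\to\mathbb R$ is continuous and of bounded variation, $\mathrm df$ denotes the signed measure on $\overline I$ (without atoms) with $\mathrm df((x,y])=f(y)-f(x)$; for bounded measurable $g$, $g\,\mathrm df$ denotes the measure $\mathrm df$ weighted with the density $g$. A solution to Luckock's equation is a pair $(f_-,f_+)$ of continuous functions $f_\pm:\overline I\to\mathbb R$ of bounded variation such that, as signed measures on $\overline I$, $$f_-\,\mathrm d\lambda_++\lambda_-\,\mathrm df_+=0,\qquad f_+\,\mathrm d\lambda_-+\lambda_+\,\mathrm df_-=0,$$ and $f_-(I_+)=1=f_+(I_-)$. *)

(* Defs.v *)
From HB Require Import structures.
From mathcomp Require Import all_boot all_order all_algebra.
From mathcomp Require Import all_classical all_reals all_analysis.
(* Not exported by all_analysis; provides the Borel sigma-algebra on \bar R. *)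
From mathcomp Require Import measurable_realfun.

Set Implicit Arguments.
Unset Strict Implicit.
Unset Printing Implicit Defensive.

Import Order.TTheory GRing.Theory Num.Theory.
Import numFieldNormedType.Exports.

Local Open Scope classical_set_scope.
Local Open Scope ring_scope.

Section signed_measures.
Context d (T : measurableType d) (R : realType).
Implicit Types (nu : {charge set T -> \bar R}) (A : set T) (g : T -> R).

(* The Jordan parts do not depend on the chosen Hahn decomposition. *)
Definition charge_pos nu : {measure set T -> \bar R} :=
  jordan_pos (svalP (cid (svalP (cid (Hahn_decomposition nu))))).

Definition charge_neg nu : {measure set T -> \bar R} :=
  jordan_neg (svalP (cid (svalP (cid (Hahn_decomposition nu))))).

(* The integral of g over A against nu; as a function of A, the signed measure
   with density g with respect to nu. Both parts of nu are finite, so no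
   infinite value is truncated when g is bounded and measurable. *)
Definition charge_integral nu A g : R :=
  (\int[charge_pos nu]_(x in A) g x - \int[charge_neg nu]_(x in A) g x)%R.

End signed_measures.

Section stieltjes.
Context (R : realType).
Implicit Types (a b : \bar R) (f : \bar R -> R).

(* [bounded_variation] of the library, for a domain inside \bar R. *)
Definition ebounded_variation a b f : Prop :=
  has_ubound [set \sum_(0 <= n < size s)
                    `|f (nth b (a :: s) n.+1) - f (nth b (a :: s) n)|
             | s in itv_partition a b].

(* Signed measures on [a, b] are encoded as charges on \bar R carried by
   [a, b]. *)
Definition is_stieltjes a b f (nu : {charge set (\bar R) -> \bar R}) : Prop :=
  [/\ forall A, measurable A -> nu A = nu (A `&` `[a, b]),
      forall x, nu [set x] = 0%E
    & forall x y, (a <= x)%E -> (x <= y)%E -> (y <= b)%E ->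
        nu `]x, y]%classic = (f y - f x)%:E].

(* The signed measure df on [a, b]. Such a charge exists, and is unique on
   measurable sets, when f is continuous and of bounded variation on [a, b];
   the default value czero is only reached otherwise. *)
Definition stieltjes a b f : {charge set (\bar R) -> \bar R} :=
  if pselect (exists nu, is_stieltjes a b f nu) is left h
  then sval (cid h) else czero.

End stieltjes.

Section luckock.
Context (R : realType).
Implicit Types (a b : \bar R) (f lm lp fm fp : \bar R -> R).

Definition continuous_BV a b f : Prop :=
  {within `[a, b], continuous f} /\ ebounded_variation a b f.

(* a = I_-, b = I_+, lm = lambda_-, lp = lambda_+, fm = f_-, fp = f_+. *)
Definition luckock_solution a b lm lp fm fp : Prop :=
  [/\ continuous_BV a b fm /\ continuous_BV a b fp,
      forall A, measurable A -> A `<=` `[a, b] ->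
        charge_integral (stieltjes a b lp) A fm
          + charge_integral (stieltjes a b fp) A lm = 0,
      forall A, measurable A -> A `<=` `[a, b] ->
        charge_integral (stieltjes a b lm) A fp
          + charge_integral (stieltjes a b fm) A lp = 0
    & fm b = 1 /\ fp a = 1].

Definition Lambda_minus a b lm lp : R :=
  1 / (lm a * lm b)
    - charge_integral (stieltjes a b (fun x => 1 / lm x)) `[a, b]%classic
        (fun x => 1 / lp x).

Definition Lambda_plus a b lm lp : R :=
  1 / (lp a * lp b)
    + charge_integral (stieltjes a b (fun x => 1 / lp x)) `[a, b]%classic
        (fun x => 1 / lm x).

End luckock.

(* Main.v *)
(** An equation such as [f_- dlambda_+ + lambda_- df_+ = 0] between signed
    measures is equivalent to its infinitesimal form: the two-point function
    [f_-(x) (lambda_+(y) - lambda_+(x)) + lambda_-(x) (f_+(y) - f_+(x))] is, for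
    [x <= y] close to any given point, an arbitrarily small multiple of the
    increment of a fixed nondecreasing function. A function whose own increments
    have this property is constant, and products of increments of continuous
    functions of bounded variation have it, which gives the product rule.

    By the product rule [f_- lambda_+ + f_+ lambda_-] is a constant [K], and then
    [d(f_- / lambda_-) = K / lambda_+ d(1/lambda_-)]. So, with [J(x)] the integral
    of [1/lambda_+ d(1/lambda_-)] over [(I_-, x]],
    [f_- / lambda_- = 1/lambda_-(I_+) - K (J(I_+) - J)], and the boundary condition
    at [I_-] determines [K]. Evaluating at the end points shows that [f_-(I_-)] and
    [f_+(I_+)] are positive multiples of [Lambda_-] and [Lambda_+]. *)

Require Import Defs.
From HB Require Import structures.
From mathcomp Require Import all_boot all_order all_algebra.
From mathcomp Require Import all_classical all_reals all_analysis.
From mathcomp Require Import measurable_realfun.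
From mathcomp Require Import ring lra.
Import Order.TTheory GRing.Theory Num.Theory.
Import numFieldNormedType.Exports.
Local Open Scope classical_set_scope.
Local Open Scope ring_scope.

Set Implicit Arguments.
Unset Strict Implicit.
Unset Printing Implicit Defensive.

(** * Infinitesimal two-point functions *)

Section within_continuity.
Context {T : topologicalType} {R : realType}.
Implicit Types (A : set T) (f g : T -> R).

(** In the subspace topology the points outside [A] are isolated, so continuity has content only at
    points of [A], where neighbourhoods are traces on [A]. *)
Lemma within_continuousP A f : {within A, continuous f} <->
  forall x, A x -> forall e, 0 < e ->
    \forall y \near x, A y -> `|f x - f y| < e.
Proof.
split=> [cf x Ax e e0|cf x].
  have /cvgrPdist_lt/(_ e e0) := cf x.
  by rewrite /nbhs/= -nbhs_subspace_in.
have [Ax|Ax] := pselect (A x); last first.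
  apply/cvgrPdist_lt => e e0.
  rewrite /prop_near1 /nbhs/= -nbhs_subspace_out//.
  by move=> y ->; rewrite subrr normr0.
apply/cvgrPdist_lt => e e0.
by rewrite /prop_near1 /nbhs/= -nbhs_subspace_in//; exact: cf.
Qed.

Lemma within_continuousM A f g : {within A, continuous f} ->
  {within A, continuous g} -> {within A, continuous (fun x => f x * g x)}.
Proof. by move=> cf cg x; apply: cvgM; [exact: cf|exact: cg]. Qed.

Lemma within_continuousB A f g : {within A, continuous f} ->
  {within A, continuous g} -> {within A, continuous (fun x => f x - g x)}.
Proof. by move=> cf cg x; apply: cvgB; [exact: cf|exact: cg]. Qed.

Lemma within_continuous_cst A (c : R) : {within A, continuous (fun=> c)}.
Proof. by move=> x; exact: cvg_cst. Qed.

End within_continuity.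

Section infinitesimal.
Context {R : realType} (a b : \bar R).
Implicit Types (f g h P tau : \bar R -> R) (Psi Phi : \bar R -> \bar R -> R).

Definition nondecreasing_on tau :=
  forall x y, (a <= x)%E -> (x <= y)%E -> (y <= b)%E -> tau x <= tau y.

(** [tau] is fixed before [e], so that errors accumulated along the interval total at most
    [e * (tau b - tau a)]. [U] may depend on [e] and [z], and [x], [y] need not lie on opposite
    sides of [z]. *)
Definition infinitesimal Psi :=
  exists2 tau, nondecreasing_on tau &
  forall e, 0 < e -> forall z, (a <= z)%E -> (z <= b)%E ->
  exists2 U, nbhs z U & forall x y, U x -> U y ->
    (a <= x)%E -> (x <= y)%E -> (y <= b)%E ->
    `|Psi x y| <= e * (tau y - tau x).

(** Bounded variation without partitions: [tau] plays the role of the variation function. *)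
Definition variation_controlled f :=
  exists2 tau, nondecreasing_on tau &
  forall x y, (a <= x)%E -> (x <= y)%E -> (y <= b)%E ->
    `|f y - f x| <= tau y - tau x.

Lemma eq_infinitesimal Psi Phi :
  (forall x y, (a <= x)%E -> (x <= y)%E -> (y <= b)%E -> Psi x y = Phi x y) ->
  infinitesimal Psi -> infinitesimal Phi.
Proof.
move=> PsiPhi [tau tau_nd h]; exists tau => // e e0 z az zb.
have [U Uz hU] := h e e0 z az zb.
by exists U => // x y Ux Uy ax xy yb; rewrite -PsiPhi//; exact: hU.
Qed.

Lemma infinitesimalD Psi Phi : infinitesimal Psi -> infinitesimal Phi ->
  infinitesimal (fun x y => Psi x y + Phi x y).
Proof.
move=> [s s_nd hs] [t t_nd ht]; exists (fun x => s x + t x).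
  by move=> x y ax xy yb; rewrite lerD ?s_nd ?t_nd.
move=> e e0 z az zb.
have [U Uz hU] := hs e e0 z az zb.
have [V Vz hV] := ht e e0 z az zb.
exists (U `&` V); first exact: filterI.
move=> x y [Ux Vx] [Uy Vy] ax xy yb; rewrite (le_trans (ler_normD _ _))//.
have := hU x y Ux Uy ax xy yb; have := hV x y Vx Vy ax xy yb.
lra.
Qed.

Lemma variation_controlled_bounded f : variation_controlled f ->
  exists2 M, 0 <= M & forall x, (a <= x)%E -> (x <= b)%E -> `|f x| <= M.
Proof.
move=> [tau tau_nd h]; exists (`|f a| + `|tau b - tau a|).
  by rewrite addr_ge0.
move=> x ax xb.
have h1 := h a x (lexx _) ax xb.
have h2 := tau_nd x b ax xb (lexx _).
have h3 := ler_norm (tau b - tau a).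
have h4 := ler_normD (f a) (f x - f a).
rewrite addrC subrK in h4.
lra.
Qed.

Lemma infinitesimalMl h Psi : variation_controlled h -> infinitesimal Psi ->
  infinitesimal (fun x y => h x * Psi x y).
Proof.
move=> /variation_controlled_bounded[M M0 hM] [tau tau_nd hPsi].
exists tau => // e e0 z az zb.
(* The tolerance [e / (M + 1)] absorbs the bound [M] on [h]; adding 1 keeps the divisor positive
   when [M = 0]. *)
have M1 : 0 < M + 1 by rewrite ltr_wpDl.
have [U Uz hU] := hPsi (e / (M + 1)) (divr_gt0 e0 M1) z az zb.
exists U => // x y Ux Uy ax xy yb.
rewrite normrM.
have tau0 : 0 <= tau y - tau x by rewrite subr_ge0 tau_nd.
rewrite (le_trans (ler_pM (normr_ge0 _) (normr_ge0 _)
  (hM x ax (le_trans xy yb)) (hU x y Ux Uy ax xy yb)))//.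
rewrite mulrA ler_wpM2r// mulrCA ler_piMr ?(ltW e0)//.
by rewrite ler_pdivrMr// mul1r lerDl.
Qed.

Lemma variation_controlled_cst (c : R) : variation_controlled (fun=> c).
Proof.
exists (fun=> 0) => [x y _ _ _|x y _ _ _]; first exact: lexx.
by rewrite !subrr normr0.
Qed.

Lemma infinitesimalZ (c : R) Psi : infinitesimal Psi ->
  infinitesimal (fun x y => c * Psi x y).
Proof. exact/infinitesimalMl/variation_controlled_cst. Qed.

Lemma infinitesimalB Psi Phi : infinitesimal Psi -> infinitesimal Phi ->
  infinitesimal (fun x y => Psi x y - Phi x y).
Proof.
move=> iPsi /(infinitesimalZ (-1)) iPhi.
by apply: eq_infinitesimal (infinitesimalD iPsi iPhi) => x y _ _ _; ring.
Qed.

(** This is the remainder in the product rule. Near [z] continuity makes the increments of [g]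
    smaller than [e], while those of [f] are dominated by the increments of [tau]. *)
Lemma infinitesimal_cross f g : variation_controlled f ->
  {within `[a, b], continuous g} ->
  infinitesimal (fun x y => (g y - g x) * (f y - f x)).
Proof.
move=> [tau tau_nd ftau] /within_continuousP cg.
exists tau => // e e0 z az zb.
have zab : `[a, b]%classic z by rewrite /= in_itv/= az.
exists [set x | `[a, b]%classic x -> `|g z - g x| < e / 2].
  exact: (cg z zab _ (divr_gt0 e0 (ltr0Sn _ 1))).
move=> x y /= Ux Uy ax xy yb.
have {}Ux : `|g z - g x| < e / 2.
  by apply: Ux; rewrite in_itv/= ax (le_trans xy).
have {}Uy : `|g z - g y| < e / 2 by apply: Uy; rewrite in_itv/= yb (le_trans ax).
rewrite normrM ler_pM// ?ftau//.
move: Ux Uy; rewrite !ltr_norml => /andP[? ?] /andP[? ?].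
by rewrite ler_norml; apply/andP; split; lra.
Qed.

Lemma variation_controlledD f g : variation_controlled f ->
  variation_controlled g -> variation_controlled (fun x => f x + g x).
Proof.
move=> [s s_nd fs] [t t_nd gt]; exists (fun x => s x + t x).
  by move=> x y ax xy yb; rewrite lerD ?s_nd ?t_nd.
move=> x y ax xy yb.
have -> : f y + g y - (f x + g x) = (f y - f x) + (g y - g x) by ring.
rewrite (le_trans (ler_normD _ _))//.
have := fs x y ax xy yb; have := gt x y ax xy yb; lra.
Qed.

Lemma variation_controlledM f g : variation_controlled f ->
  variation_controlled g -> variation_controlled (fun x => f x * g x).
Proof.
move=> vf vg.
have [M M0 fM] := variation_controlled_bounded vf.
have [N N0 gN] := variation_controlled_bounded vg.
move: vf vg => [s s_nd fs] [t t_nd gt]; exists (fun x => N * s x + M * t x).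
  by move=> x y ax xy yb; rewrite lerD// ler_wpM2l// ?s_nd ?t_nd.
move=> x y ax xy yb.
have -> : f y * g y - f x * g x = (f y - f x) * g y + f x * (g y - g x) by ring.
rewrite (le_trans (ler_normD _ _))// !normrM.
have h1 := ler_pM (normr_ge0 _) (normr_ge0 _) (fs x y ax xy yb)
  (gN y (le_trans ax xy) yb).
have h2 := ler_pM (normr_ge0 _) (normr_ge0 _) (fM x ax (le_trans xy yb))
  (gt x y ax xy yb).
lra.
Qed.

Lemma variation_controlled_nondecreasing f :
  nondecreasing_on f -> variation_controlled f.
Proof.
move=> f_nd; exists f => // x y ax xy yb.
by rewrite ger0_norm// subr_ge0 f_nd.
Qed.

Lemma variation_controlledB f g : variation_controlled f ->
  variation_controlled g -> variation_controlled (fun x => f x - g x).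
Proof.
move=> vf vg.
have := variation_controlledD vf
  (variation_controlledM (variation_controlled_cst (-1)) vg).
by under eq_fun do rewrite mulN1r.
Qed.

(* The set of points y with q y <= q a contains its supremum by the local
   hypothesis there, and the supremum cannot be smaller than b. *)
Lemma locally_nonincreasing (ab : (a <= b)%E) (q : \bar R -> R) :
  (forall z, (a <= z)%E -> (z <= b)%E -> exists2 U, nbhs z U &
    forall x y, U x -> U y -> (a <= x)%E -> (x <= y)%E -> (y <= b)%E ->
      q y <= q x) ->
  q b <= q a.
Proof.
move=> loc.
pose S := [set y | [/\ (a <= y)%E, (y <= b)%E & q y <= q a]].
have Sa : S a by split.
have S0 : S !=set0 by exists a.
pose s := ereal_sup S.
have as_ : (a <= s)%E by exact: ereal_sup_ubound.
have sb : (s <= b)%E by apply: ge_ereal_sup => y [].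
have [U /nbhs_ballP[e /= e0 eU] locU] := loc s as_ sb.
have Us : U s by apply: eU; exact: ballxx.
(* The supremum may be infinite, and balls in [\bar R] are measured after [contract]; approximation
   from below is therefore done for the bounded real set of contracted values. *)
have hsup : has_sup (@contract R @` S).
  split; first by exists (contract a), a.
  by exists 1 => _ [y _ <-]; rewrite (le_trans (ler_norm _))// contract_le1.
have [_ [t St <-] st] := sup_adherent e0 hsup.
rewrite -contract_sup// -/s in st.
have ts : (t <= s)%E by exact: ereal_sup_ubound.
have Ut : U t.
  apply: eU; rewrite /ball/= /ereal_ball ger0_norm; first by lra.
  by rewrite subr_ge0 le_contract.
have Ss : q s <= q a.
  by have [at_ tb qt] := St; apply: le_trans qt; exact: locU.
move: sb; rewrite le_eqVlt => /predU1P[<-//|sb].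
(* If [s < b], then [expand c] lies to the right of [s], still in [U] and at most [b]; it belongs to
   [S], which contradicts the choice of [s]. *)
pose c := Num.min (contract b) (contract s + e / 2).
have csb : contract s < contract b by rewrite lt_contract.
have cb : c <= contract b by rewrite /c ge_min lexx.
have sc : contract s < c by rewrite lt_min csb ltrDl divr_gt0.
have c1 : `|c| <= 1.
  have := contract_le1 s; have := contract_le1 b.
  by rewrite !ler_norml => /andP[? ?] /andP[? ?]; apply/andP; split; lra.
have cK : contract (expand c) = c by rewrite expandK.
have st' : (s < expand c)%E by rewrite -lt_contract cK.
have tb' : (expand c <= b)%E by rewrite -le_contract cK.
have Uc : U (expand c).
  apply: eU; rewrite /ball/= /ereal_ball cK ler0_norm ?opprB; last by lra.
  have : c <= contract s + e / 2 by rewrite /c ge_min lexx orbT.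
  lra.
have : S (expand c).
  split=> //; first by rewrite (le_trans as_)// ltW.
  by apply: le_trans Ss; apply: locU => //; exact: ltW.
by move=> /ereal_sup_ubound; rewrite -/s leNgt st'.
Qed.

(** Adding the small multiple [d * tau] to [P] turns the approximate local inequality into an exact
    one, so [locally_nonincreasing] applies to [- P - d * tau]. *)
Lemma infinitesimal_ge (ab : (a <= b)%E) P Psi : infinitesimal Psi ->
  (forall x y, (a <= x)%E -> (x <= y)%E -> (y <= b)%E -> Psi x y <= P y - P x) ->
  P a <= P b.
Proof.
move=> [tau tau_nd hPsi] PsiP.
apply/ler_addgt0Pr => e e0.
(* Chosen so that the total error [d * (tau b - tau a)] is at most [e]. *)
pose d := e / (tau b - tau a + 1).
have tau0 : 0 <= tau b - tau a by rewrite subr_ge0 tau_nd.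
have d0 : 0 < d by rewrite divr_gt0// ltr_wpDl.
have : - P b - d * tau b <= - P a - d * tau a.
  apply: (@locally_nonincreasing ab (fun x => - P x - d * tau x)).
  move=> z az zb; have [U Uz hU] := hPsi d d0 z az zb.
  exists U => // x y Ux Uy ax xy yb.
  have := PsiP x y ax xy yb; have := hU x y Ux Uy ax xy yb.
  rewrite ler_norml => /andP[? ?]; lra.
have : d * (tau b - tau a) <= e.
  rewrite /d mulrAC ler_pdivrMr ?ltr_wpDl// ler_wpM2l ?(ltW e0)//.
  by rewrite lerDl.
lra.
Qed.

End infinitesimal.

Lemma infinitesimal_subitv {R : realType} (a b c d : \bar R) Psi :
  (a <= c)%E -> (d <= b)%E -> infinitesimal a b Psi -> infinitesimal c d Psi.
Proof.
move=> ac db [tau tau_nd h]; exists tau.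
  by move=> x y cx xy yd; rewrite tau_nd ?(le_trans ac) ?(le_trans yd).
move=> e e0 z cz zd.
have [U Uz hU] := h e e0 z (le_trans ac cz) (le_trans zd db).
by exists U => // x y Ux Uy cx xy yd; rewrite hU ?(le_trans ac) ?(le_trans yd).
Qed.

(** On the subinterval from [x] to [y], the previous comparison is applied to both [P] and [- P],
    with their own increments as two-point functions. *)
Lemma infinitesimal_increments_eq {R : realType} (a b : \bar R) P :
  infinitesimal a b (fun x y => P y - P x) ->
  forall x y, (a <= x)%E -> (x <= y)%E -> (y <= b)%E -> P x = P y.
Proof.
move=> /[swap] x /[swap] y iP ax xy yb.
have {}iP := infinitesimal_subitv ax yb iP.
apply/eqP; rewrite eq_le (infinitesimal_ge xy iP)//=.
rewrite -lerN2; apply: (infinitesimal_ge xy (P := fun x => - P x)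
  (infinitesimalZ (-1) iP)) => u v _ _ _.
lra.
Qed.

(** * Integration against a charge *)

Section measure_integral.
Context d (T : measurableType d) (R : realType).
Context (mu : {measure set T -> \bar R}).
Implicit Types (A B : set T) (g : T -> R) (M c e : R).

Lemma bounded_integrable A g M : measurable A -> mu A \is a fin_num ->
  measurable_fun A g -> (forall x, A x -> `|g x| <= M) ->
  mu.-integrable A (EFin \o g).
Proof.
move=> mA finA mg gM; apply: measurable_bounded_integrable => //.
  by rewrite ltey_eq finA.
exists M; split; first exact: num_real.
by move=> N MN x Ax /=; exact: le_trans (gM _ Ax) (ltW MN).
Qed.

Lemma Rintegral_dist_cst A g c e : measurable A -> mu A \is a fin_num ->
  measurable_fun A g -> (forall x, A x -> `|g x - c| <= e) ->
  `|\int[mu]_(x in A) g x - c * fine (mu A)| <= e * fine (mu A).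
Proof.
move=> mA finA mg gce.
have ig : mu.-integrable A (EFin \o g).
  apply: (@bounded_integrable _ _ (`|c| + e)) => // x Ax.
  by rewrite -[g x](subrK c) addrC (le_trans (ler_normD _ _))// lerD2l gce.
have ic (k : R) : mu.-integrable A (EFin \o fun=> k).
  by apply: (@bounded_integrable _ _ `|k|).
have igc : mu.-integrable A (EFin \o fun x => g x - c).
  apply: (@bounded_integrable _ _ e) => //.
  exact: measurable_funB.
rewrite -!Rintegral_cst// -RintegralB//.
rewrite (le_trans (le_normr_Rintegral mA igc))//.
apply: le_Rintegral => //.
apply: (@bounded_integrable _ _ e) => //.
  by apply: measurableT_comp => //; exact: measurable_funB.
by move=> x Ax; rewrite normr_id gce.
Qed.

End measure_integral.

Section charge_integral.
Context d (T : measurableType d) (R : realType).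
Context (nu : {charge set T -> \bar R}).
Implicit Types (A B D : set T) (g : T -> R) (M c e : R).

Lemma charge_pos_fin_num A : measurable A -> charge_pos nu A \is a fin_num.
Proof. by move=> mA; rewrite /charge_pos fin_num_measure. Qed.

Lemma charge_neg_fin_num A : measurable A -> charge_neg nu A \is a fin_num.
Proof. by move=> mA; rewrite /charge_neg fin_num_measure. Qed.

Lemma charge_pos_neg A : measurable A ->
  fine (nu A) = fine (charge_pos nu A) - fine (charge_neg nu A).
Proof.
move=> mA.
rewrite -fineB; [|exact: charge_pos_fin_num|exact: charge_neg_fin_num].
congr fine; rewrite /charge_pos /charge_neg.
have := jordan_decomp
  (svalP (cid (svalP (cid (Hahn_decomposition nu))))) mA.
by rewrite /cadd/= /cscale/= mulN1e.
Qed.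

(** The total variation measure of [nu], as a real number. *)
Definition charge_mass A := fine (charge_pos nu A) + fine (charge_neg nu A).

Lemma charge_mass_ge0 A : 0 <= charge_mass A.
Proof. by rewrite addr_ge0// fine_ge0. Qed.

Lemma normr_charge_le A : measurable A -> `|fine (nu A)| <= charge_mass A.
Proof.
move=> mA; rewrite charge_pos_neg// (le_trans (ler_normB _ _))//.
by rewrite !ger0_norm// fine_ge0.
Qed.

Lemma charge_massU A B : measurable A -> measurable B -> [disjoint A & B] ->
  charge_mass (A `|` B) = charge_mass A + charge_mass B.
Proof.
move=> mA mB /disj_setPS AB.
have AB0 : A `&` B = set0 by apply/seteqP; split.
rewrite /charge_mass !measureU// !fineD;
  do ?[exact: charge_pos_fin_num|exact: charge_neg_fin_num].
ring.
Qed.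

Lemma charge_integral_dist_cst A g c e : measurable A ->
  measurable_fun A g -> (forall x, A x -> `|g x - c| <= e) ->
  `|charge_integral nu A g - c * fine (nu A)| <= e * charge_mass A.
Proof.
move=> mA mg gce.
have hp := Rintegral_dist_cst mA (charge_pos_fin_num mA) mg gce.
have hn := Rintegral_dist_cst mA (charge_neg_fin_num mA) mg gce.
rewrite /charge_integral charge_pos_neg// /charge_mass.
move: hp hn; rewrite !ler_norml => /andP[? ?] /andP[? ?].
by apply/andP; split; lra.
Qed.

Lemma charge_integralU A B g M : measurable A -> measurable B ->
  [disjoint A & B] -> measurable_fun (A `|` B) g ->
  (forall x, (A `|` B) x -> `|g x| <= M) ->
  charge_integral nu (A `|` B) g =
  charge_integral nu A g + charge_integral nu B g.
Proof.
move=> mA mB AB mg gM; rewrite /charge_integral.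
have mAB : measurable (A `|` B) by exact: measurableU.
rewrite !Rintegral_setU//; [ring|exact: bounded_integrable
  (charge_neg_fin_num mAB) mg gM|exact: bounded_integrable
  (charge_pos_fin_num mAB) mg gM].
Qed.

(** Extended by 0 outside [D], the density is integrable over the whole space against both Jordan
    parts, and the two induced charges can be subtracted. This makes the weighted measure a genuine
    charge, to which uniqueness results apply. *)
Lemma weighted_charge D g M : measurable D -> measurable_fun D g ->
  (forall x, D x -> `|g x| <= M) ->
  exists rho : {charge set T -> \bar R}, forall A, measurable A ->
    rho A = (charge_integral nu (A `&` D) g)%:E.
Proof.
move=> mD mg gM.
have ip : (charge_pos nu).-integrable D (EFin \o g).
  exact: bounded_integrable (charge_pos_fin_num mD) mg gM.
have in_ : (charge_neg nu).-integrable D (EFin \o g).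
  exact: bounded_integrable (charge_neg_fin_num mD) mg gM.
have jp := ip; have jn := in_.
rewrite integrable_mkcond// in jp; rewrite integrable_mkcond// in jn.
exists (cadd (induced_charge jp) (copp (induced_charge jn))) => A mA.
transitivity (\int[charge_pos nu]_(x in A) ((EFin \o g) \_ D) x
  - \int[charge_neg nu]_(x in A) ((EFin \o g) \_ D) x)%E => //.
rewrite -!integral_mkcondr.
rewrite /charge_integral EFinB /Rintegral !fineK//.
- apply: integrable_fin_num; first exact: measurableI.
  by apply: integrableS in_ => //; exact: measurableI.
- apply: integrable_fin_num; first exact: measurableI.
  by apply: integrableS ip => //; exact: measurableI.
Qed.

End charge_integral.

(** * Borel measurability on the extended real line *)

Section ereal_measurability.
Context {R : realType}.
Implicit Types (A V : set (\bar R)) (g : \bar R -> R).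

(** Split [V] into its real part, which is open in [R], and the points at infinity that it
    contains. *)
Lemma ereal_open_measurable V : open V -> measurable V.
Proof.
move=> oV; have -> : V = EFin @` (EFin @^-1` V)
    `|` ([set +oo%E] `&` V) `|` ([set -oo%E] `&` V).
  apply/seteqP; split=> [[r| |] Vx|x [[[r Vr <-//]|[]]|[]]//].
  - by left; left; exists r.
  - by left; right.
  - by right.
have cst_meas x : measurable ([set x] `&` V).
  have [Vx|Vx] := pselect (V x).
    have -> : [set x] `&` V = [set x] by apply/setIidl => _ ->.
    exact: emeasurable_set1.
  have -> : [set x] `&` V = set0 by apply/seteqP; split => // y [->].
  exact: measurable0.
apply: measurableU; last exact: cst_meas.
apply: measurableU; last exact: cst_meas.
apply: measurable_image_EFin; apply: open_measurable.
rewrite openE => r Vr; apply/nbhs_EFin.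
by move: oV; rewrite openE => /(_ _ Vr).
Qed.

Lemma within_continuous_measurable A g : measurable A ->
  {within A, continuous g} -> measurable_fun A g.
Proof.
move=> mA /continuousP cg; apply: (measurability _ (RGenOpens.measurableE R)).
move=> _ [_ [x [y ->] <-]].
have /open_subspaceP[V oV VA] := cg _ (interval_open (a := BRight x)
  (b := BLeft y) isT isT).
by rewrite setIC -VA; apply: measurableI => //; exact: ereal_open_measurable.
Qed.

End ereal_measurability.

(** * Uniqueness of charges *)

Section charge_eq0.
Context {R : realType} (a b : \bar R).
Context (rho : {charge set (\bar R) -> \bar R}).

(** Dynkin's theorem for the generating rays from [r] to [+oo]: cut down to [[a, b]], such a ray is
    empty, all of [[a, b]], or []r, b]]. The value at [[set a]] accounts for the left end point of
    [[a, b]]. *)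
Lemma charge_eq0_itv : (a <= b)%E -> rho [set a] = 0%E ->
  (forall x y, (a <= x)%E -> (x <= y)%E -> (y <= b)%E ->
     rho `]x, y]%classic = 0%E) ->
  forall A, measurable A -> rho (A `&` `[a, b]) = 0%E.
Proof.
move=> ab rhoa rho0 A mA.
have mab : measurable `[a, b]%classic by exact: emeasurable_itv.
have rhoab : rho `[a, b]%classic = 0%E.
  rewrite -(@setU1itv _ _ (BRight b) a false)//.
  rewrite chargeU//; [|exact: emeasurable_itv|].
    by rewrite rhoa rho0// adde0.
  by apply/seteqP; split=> // x [->]; rewrite /= in_itv/= ltxx.
have mE := ErealGenOInfty.measurableE R.
apply: (@dynkin_induction _ _ (@ErealGenOInfty.G R)
  (fun B => rho (B `&` `[a, b]) = 0%E)) => //.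
- move=> _ _ [r ->] [s ->]; exists (Num.max r s).
  apply/seteqP; split=> x /=; rewrite !in_itv/= !andbT EFin_max gt_max.
    by move=> [-> ->].
  by move=> /andP[].
- by rewrite setTI.
- move=> _ [r ->].
  have [ra|ar] := ltP r%:E a.
    rewrite [X in rho X](_ : _ = `[a, b]%classic)//.
    apply/seteqP; split=> [x []//|x /= xab]; split => //; move: xab.
    by rewrite !in_itv/= andbT => /andP[ax _]; exact: lt_le_trans ax.
  have [br|rb] := ltP b r%:E.
    rewrite [X in rho X](_ : _ = set0) ?charge0//.
    apply/seteqP; split=> // x [] /=; rewrite !in_itv/= andbT => rx /andP[_ xb].
    by have := lt_trans br (lt_le_trans rx xb); rewrite ltxx.
  rewrite [X in rho X](_ : _ = `]r%:E, b]%classic) ?rho0//.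
  apply/seteqP; split=> x /=; rewrite !in_itv/= andbT.
    by move=> [-> /andP[]].
  by move=> /andP[rx ->]; rewrite rx (le_trans ar (ltW rx)).
- move=> B mB B0.
  have := chargeDI rho mab mB; rewrite rhoab [in X in (_ + X)%E]setIC B0.
  by rewrite adde0 setDE setIC => <-.
- move=> F mF tF F0; rewrite setI_bigcupl.
  have mF' n : measurable (F n `&` `[a, b]) by exact: measurableI.
  have tF' : trivIset setT (fun n => F n `&` `[a, b]).
    exact: trivIset_setIr.
  have : semi_sigma_additive rho by exact: charge_semi_sigma_additive.
  move=> /(_ _ mF' tF' (bigcupT_measurable _ mF')).
  rewrite [X in X @ _ --> _](_ : _ = fun=> 0%E); last first.
    by apply/funext => n; rewrite big1.
  by move=> /cvg_lim <-//; rewrite lim_cst.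
- suff : (@ErealGenOInfty.G R).-sigma.-measurable A by [].
  by rewrite -mE.
Qed.

End charge_eq0.

(** * Indefinite Stieltjes integrals *)

(** An increment of [P] is a small multiple of an increment of [tau] plus [g x * (f y - f x)], where
    [g] is bounded and [f] is continuous. *)
Lemma continuous_infinitesimal {R : realType} (a b : \bar R) (P f g : \bar R -> R) :
  infinitesimal a b (fun x y => P y - P x - g x * (f y - f x)) ->
  variation_controlled a b g -> {within `[a, b], continuous f} ->
  {within `[a, b], continuous P}.
Proof.
move=> [tau tau_nd h] /variation_controlled_bounded[M M0 gM].
move=> /within_continuousP cf; apply/within_continuousP => z zab e e0.
have := zab; rewrite /= in_itv/= => /andP[az zb].
pose V := tau b - tau a.
have V0 : 0 <= V by rewrite subr_ge0 tau_nd// (le_trans az).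
(* Each of the two contributions receives half of [e]: [V] bounds the increments of [tau], and [M]
   bounds [g]. *)
have d0 : 0 < e / 2 / (V + 1) by rewrite !divr_gt0// ltr_wpDl.
have d1 : 0 < e / 2 / (M + 1) by rewrite !divr_gt0// ltr_wpDl.
have [U Uz hU] := h _ d0 z az zb.
have key x y : U x -> U y -> (a <= x)%E -> (x <= y)%E -> (y <= b)%E ->
    `|f y - f x| < e / 2 / (M + 1) -> `|P y - P x| < e.
  move=> Ux Uy ax xy yb fxy.
  have h1 := hU x y Ux Uy ax xy yb.
  have h2 : e / 2 / (V + 1) * (tau y - tau x) <= e / 2.
    rewrite mulrAC ler_pdivrMr ?ltr_wpDl// ler_wpM2l//.
      by rewrite divr_ge0// ltW.
    have xb := tau_nd y b (le_trans ax xy) yb (lexx _).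
    have := tau_nd a x (lexx _) ax (le_trans xy yb).
    rewrite /V; lra.
  have h3 : `|g x * (f y - f x)| < e / 2.
    rewrite normrM.
    have := ler_pM (normr_ge0 _) (normr_ge0 _)
      (gM x ax (le_trans xy yb)) (ltW fxy).
    move=> /le_lt_trans; apply; rewrite mulrCA gtr_pMr ?divr_gt0//.
    by rewrite ltr_pdivrMr ?ltr_wpDl// mul1r ltrDl.
  rewrite -[P y - P x](subrK (g x * (f y - f x))).
  rewrite (le_lt_trans (ler_normD _ _))//; lra.
near=> y.
move=> yab; have := yab; rewrite /= in_itv/= => /andP[ay yb].
have Uy : U y by near: y.
have fzy : `|f z - f y| < e / 2 / (M + 1).
  by move: yab; near: y; exact: cf.
have [yz|/ltW zy] := leP y z.
  by apply: key => //; exact: nbhs_singleton.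
by rewrite distrC; apply: key => //; [exact: nbhs_singleton|rewrite distrC].
Unshelve. all: by end_near. Qed.

Lemma ereal_itv_oc_setU {R : realType} (x y z : \bar R) :
  (x <= y)%E -> (y <= z)%E ->
  `]x, z]%classic = `]x, y]%classic `|` `]y, z]%classic.
Proof. by move=> xy yz; rewrite -itv_bndbnd_setU. Qed.

Lemma ereal_itv_oc_disjoint {R : realType} (x y z : \bar R) :
  [disjoint `]x, y]%classic & `]y, z]%classic].
Proof.
apply/disj_setPS => u [] /=; rewrite !in_itv/= => /andP[_ uy] /andP[yu _].
by have := lt_le_trans yu uy; rewrite ltxx.
Qed.

Section stieltjes_integral.
Context {R : realType} (a b : \bar R).
Context (nu : {charge set (\bar R) -> \bar R}) (f g : \bar R -> R).
Context (nuf : is_stieltjes a b f nu).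
Context (cg : {within `[a, b], continuous g}) (vg : variation_controlled a b g).

Let mitv x y : measurable (`]x, y]%classic : set (\bar R)).
Proof. exact: emeasurable_itv. Qed.

Let sub_ab x y : (a <= x)%E -> (y <= b)%E -> `]x, y] `<=` `[a, b].
Proof.
move=> ax yb u /=; rewrite !in_itv/= => /andP[xu uy].
by rewrite (le_trans ax (ltW xu)) (le_trans uy yb).
Qed.

Lemma within_continuous_measurable_sub A : A `<=` `[a, b] ->
  measurable_fun A g.
Proof.
move=> Aab; apply: measurable_funS Aab _; first exact: emeasurable_itv.
by apply: within_continuous_measurable => //; exact: emeasurable_itv.
Qed.
Let mg := within_continuous_measurable_sub.

Let charge_itv x y : (a <= x)%E -> (x <= y)%E -> (y <= b)%E ->
  fine (nu `]x, y]%classic) = f y - f x.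
Proof. by case: nuf => _ _ H ax xy yb; rewrite H. Qed.

Let massD x y : (a <= x)%E -> (x <= y)%E ->
  charge_mass nu `]x, y] = charge_mass nu `]a, y] - charge_mass nu `]a, x].
Proof.
move=> ax xy; rewrite (ereal_itv_oc_setU ax xy) charge_massU//; first ring.
exact: ereal_itv_oc_disjoint.
Qed.

Let mass_nd : nondecreasing_on a b (fun x => charge_mass nu `]a, x]).
Proof. by move=> x y ax xy yb; rewrite -subr_ge0 -massD// charge_mass_ge0. Qed.

Lemma stieltjes_variation_controlled : variation_controlled a b f.
Proof.
exists (fun x => charge_mass nu `]a, x]) => // x y ax xy yb.
by rewrite -massD// -charge_itv// normr_charge_le.
Qed.

Lemma charge_integral_itvD x y : (a <= x)%E -> (x <= y)%E -> (y <= b)%E ->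
  charge_integral nu `]x, y]%classic g =
  charge_integral nu `]a, y]%classic g - charge_integral nu `]a, x]%classic g.
Proof.
move=> ax xy yb; have [M M0 gM] := variation_controlled_bounded vg.
rewrite (ereal_itv_oc_setU ax xy) (@charge_integralU _ _ _ _ _ _ _ M)//.
- ring.
- exact: ereal_itv_oc_disjoint.
- by apply: mg; rewrite -ereal_itv_oc_setU//; exact: sub_ab.
- move=> u; rewrite -ereal_itv_oc_setU// => /(@sub_ab a y (lexx _) yb) /=.
  by rewrite in_itv/= => /andP[au ub]; exact: gM.
Qed.

(** Near [z] the integrand differs from [g x] by at most [e], so the error on []x, y]] is at most
    [e] times the mass of that interval, an increment of the cumulative mass. *)
Lemma charge_integral_infinitesimal :
  infinitesimal a b
    (fun x y => charge_integral nu `]x, y]%classic g - g x * (f y - f x)).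
Proof.
exists (fun x => charge_mass nu `]a, x]) => // e e0 z az zb.
have zab : `[a, b]%classic z by rewrite /= in_itv/= az.
have /within_continuousP/(_ z zab (e / 2)) := cg.
move=> /(_ (divr_gt0 e0 (ltr0Sn _ 1))) /nbhs_ballP[r /= r0 rg].
exists (ball z r); first exact: nbhsx_ballx.
move=> x y zx zy ax xy yb; rewrite -massD// -charge_itv//.
apply: charge_integral_dist_cst => //; first exact/mg/sub_ab.
move=> u xyu; have := sub_ab ax yb xyu.
have gzx : `|g z - g x| < e / 2.
  by apply: rg => //=; rewrite in_itv/= ax (le_trans xy).
(* [contract] is monotone, so balls are order-convex and contain every point between [x] and [y]. *)
have zu : ball z r u.
  move: zx zy; rewrite /ball/= /ereal_ball !ltr_norml.
  move: xyu; rewrite /= in_itv/= => /andP[/ltW + +].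
  rewrite -!le_contract => ? ? /andP[? ?] /andP[? ?].
  by apply/andP; split; lra.
move=> /(rg u zu); move: gzx; rewrite !ltr_norml => /andP[? ?] /andP[? ?].
by rewrite ler_norml; apply/andP; split; lra.
Qed.

Lemma charge_integral_variation_controlled :
  variation_controlled a b (fun x => charge_integral nu `]a, x]%classic g).
Proof.
have [M M0 gM] := variation_controlled_bounded vg.
exists (fun x => M * charge_mass nu `]a, x]) => x y ax xy yb.
  by rewrite ler_wpM2l// mass_nd.
rewrite -charge_integral_itvD// -mulrBr -massD//.
rewrite -[charge_integral _ _ _]subr0 -(mul0r (fine (nu `]x, y]%classic))).
apply: charge_integral_dist_cst => //; first exact/mg/sub_ab.
move=> u /(sub_ab ax yb) /=; rewrite in_itv/= subr0 => /andP[au ub].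
exact: gM.
Qed.

Lemma charge_integral_set1 : (a <= b)%E -> charge_integral nu [set a] g = 0.
Proof.
move=> ab; case: nuf => _ nu1 _; apply/eqP; rewrite -normr_le0.
(* On a singleton [g] equals the constant [g a], so the estimate holds with error 0. *)
have /(_ (g a) 0) := @charge_integral_dist_cst _ _ _ nu _ g _ _ (emeasurable_set1 a).
rewrite nu1 mulr0 subr0 mul0r; apply.
  by apply: mg => _ ->; rewrite /= in_itv/= lexx.
by move=> _ ->; rewrite subrr normr0.
Qed.

Lemma charge_integral_segment : (a <= b)%E ->
  charge_integral nu `[a, b]%classic g = charge_integral nu `]a, b]%classic g.
Proof.
move=> ab; have [M M0 gM] := variation_controlled_bounded vg.
have abE := @setU1itv _ _ (BRight b) a false ab.
rewrite -abE (@charge_integralU _ _ _ _ _ _ _ M)//.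
- by rewrite charge_integral_set1// add0r.
- apply/disj_setPS => u [-> /=]; rewrite in_itv/= ltxx//.
- by rewrite abE; exact: mg.
- by move=> u; rewrite abE /= in_itv/= => /andP[]; exact: gM.
Qed.

End stieltjes_integral.

(** * Equations between weighted signed measures *)

Section density_equation.
Context {R : realType} (a b : \bar R) (ab : (a <= b)%E).
Context (nu1 nu2 : {charge set (\bar R) -> \bar R}) (f1 f2 g1 g2 : \bar R -> R).
Context (nuf1 : is_stieltjes a b f1 nu1) (nuf2 : is_stieltjes a b f2 nu2).
Context (cg1 : {within `[a, b], continuous g1})
  (vg1 : variation_controlled a b g1).
Context (cg2 : {within `[a, b], continuous g2})
  (vg2 : variation_controlled a b g2).

(** Forwards, test the measure identity on []x, y]] and replace each integral by its infinitesimal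
    approximation. Backwards, the sum of the indefinite integrals has infinitesimal increments and
    so is constant; the weighted charge then vanishes on all []x, y]] and at [a], hence on every
    measurable subset of [[a, b]]. *)
Lemma density_equationP :
  (forall A, measurable A -> A `<=` `[a, b] ->
     charge_integral nu1 A g1 + charge_integral nu2 A g2 = 0) <->
  infinitesimal a b
    (fun x y => g1 x * (f1 y - f1 x) + g2 x * (f2 y - f2 x)).
Proof.
have i1 := charge_integral_infinitesimal nuf1 cg1.
have i2 := charge_integral_infinitesimal nuf2 cg2.
split=> [eq0|i0 A mA Aab].
  have := infinitesimalZ (-1) (infinitesimalD i1 i2).
  apply: eq_infinitesimal => x y ax xy yb.
  have := eq0 `]x, y]%classic (emeasurable_itv _).
  have sub : `]x, y] `<=` `[a, b].
    move=> u /=; rewrite !in_itv/= => /andP[xu uy].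
    by rewrite (le_trans ax (ltW xu)) (le_trans uy yb).
  move=> /(_ sub); lra.
have itvD := charge_integral_itvD nu1 cg1 vg1.
have itvD' := charge_integral_itvD nu2 cg2 vg2.
have eq0 x y : (a <= x)%E -> (x <= y)%E -> (y <= b)%E ->
    charge_integral nu1 `]x, y]%classic g1
    + charge_integral nu2 `]x, y]%classic g2 = 0.
  move=> ax xy yb; rewrite itvD// itvD'//.
  pose P x := charge_integral nu1 `]a, x]%classic g1
    + charge_integral nu2 `]a, x]%classic g2.
  suff : P x = P y by rewrite /P; lra.
  apply: (@infinitesimal_increments_eq _ a b) => //.
  have := infinitesimalD i0 (infinitesimalD i1 i2).
  apply: eq_infinitesimal => u v au uv vb.
  rewrite itvD// itvD'// /P; ring.
have mab : measurable (`[a, b]%classic : set (\bar R)) by exact: emeasurable_itv.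
have [M1 _ gM1] := variation_controlled_bounded vg1.
have [M2 _ gM2] := variation_controlled_bounded vg2.
have bg1 x : `[a, b]%classic x -> `|g1 x| <= M1.
  by rewrite /= in_itv/= => /andP[]; exact: gM1.
have bg2 x : `[a, b]%classic x -> `|g2 x| <= M2.
  by rewrite /= in_itv/= => /andP[]; exact: gM2.
have [rho1 rho1E] :=
  weighted_charge nu1 mab (within_continuous_measurable mab cg1) bg1.
have [rho2 rho2E] :=
  weighted_charge nu2 mab (within_continuous_measurable mab cg2) bg2.
have [rho rhoE] : exists rho : {charge set (\bar R) -> \bar R},
    forall B, measurable B -> B `<=` `[a, b] -> rho B =
    (charge_integral nu1 B g1 + charge_integral nu2 B g2)%:E.
  exists (cadd rho1 rho2) => B mB /setIidl Bab.
  transitivity (rho1 B + rho2 B)%E => //.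
  by rewrite (rho1E B mB) (rho2E B mB) Bab EFinD.
have := @charge_eq0_itv _ a b rho ab _ _ A mA.
rewrite (setIidl Aab) (rhoE A mA Aab) => H; apply/eqP; rewrite -eqe; apply/eqP.
apply: H.
  rewrite rhoE; [|exact: emeasurable_set1|].
    by rewrite (charge_integral_set1 nuf1)// (charge_integral_set1 nuf2)// addr0.
  by move=> _ ->; rewrite /= in_itv/= lexx.
move=> x y ax xy yb; rewrite rhoE; [|exact: emeasurable_itv|].
  by rewrite eq0.
move=> u /=; rewrite !in_itv/= => /andP[xu uy].
by rewrite (le_trans ax (ltW xu)) (le_trans uy yb).
Qed.

End density_equation.

(** * Existence of Stieltjes charges on the extended line *)

Lemma measurable_expand {R : realType} : measurable_fun setT (@expand R).
Proof.
apply: (measurability _ (ErealGenOInfty.measurableE R)).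
move=> _ [_ [r ->] <-]; rewrite setTI; apply: is_interval_measurable.
move=> x y /=; rewrite !in_itv/= !andbT => rx ry z /andP[xz zy].
by rewrite in_itv/= andbT (lt_le_trans rx)// le_expand.
Qed.

(** * Transport of functions to a compact real interval *)

Section contract_interval.
Context {R : realType} (a b : \bar R).
Context (ab : (a < b)%E).
Implicit Types (r s : R) (f : \bar R -> R).
Let alpha := contract a.
Let beta := contract b.

Let alphabeta : alpha < beta. Proof. by rewrite lt_contract. Qed.

Lemma contract_expand_in r : alpha <= r <= beta -> contract (expand r) = r.
Proof.
move=> /andP[ar rb]; apply: expandK; rewrite inE ler_norml.
have := contract_le1 a; have := contract_le1 b.
rewrite !ler_norml -/alpha -/beta => /andP[? ?] /andP[? ?].
by apply/andP; split; lra.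
Qed.

Lemma expand_in r : alpha <= r <= beta -> (a <= expand r <= b)%E.
Proof. by move=> rab; rewrite -!le_contract (contract_expand_in rab). Qed.

Lemma contract_in x : (a <= x <= b)%E -> alpha <= contract x <= beta.
Proof. by rewrite !le_contract. Qed.

(* f, transported to [contract a, contract b] and extended by constants to R *)
Definition clamped f r := f (expand (Num.max alpha (Num.min r beta))).

Let clamp_in r : alpha <= Num.max alpha (Num.min r beta) <= beta.
Proof. by rewrite le_max lexx/= ge_max (ltW alphabeta)/= ge_min lexx orbT. Qed.

Lemma clampedE f x : (a <= x <= b)%E -> clamped f (contract x) = f x.
Proof.
move=> /contract_in/andP[ax xb].
by rewrite /clamped (min_idPl xb) (max_idPr ax) contractK.
Qed.

Lemma clamped_nondecreasing f : nondecreasing_on a b f ->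
  {homo clamped f : x y / x <= y}.
Proof.
move=> fnd x y xy; have /expand_in/andP[ax _] := clamp_in x.
have /expand_in/andP[_ yb] := clamp_in y.
apply: fnd => //; apply: le_expand.
by have := alphabeta; rewrite !maxEle !minEle;
  do !case: ifPn; rewrite -?ltNge => *; lra.
Qed.

(** Clamping is 1-Lipschitz and distances in [\bar R] are measured after [contract], so the radius
    found for [f] serves unchanged for [clamped f]. *)
Lemma clamped_continuous  f : {within `[a, b], continuous f} ->
  continuous (clamped f).
Proof.
move=> /within_continuousP cf r; apply/cvgrPdist_lt => e e0.
set z := Num.max alpha (Num.min r beta).
have zab : `[a, b]%classic (expand z) by rewrite /= in_itv/=; exact/expand_in/clamp_in.
have /nbhs_ballP[d /= d0 df] := cf _ zab e e0.
apply/nbhs_ballP; exists d => // s rs; apply: df; last first.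
  by rewrite /= in_itv/=; exact/expand_in/clamp_in.
rewrite /ball/= /ereal_ball /z.
rewrite (contract_expand_in (clamp_in r)) (contract_expand_in (clamp_in s)).
move: rs; rewrite /ball/=; apply: le_lt_trans.
have := alphabeta; rewrite !maxEle !minEle.
have := ler_norm (r - s); have := ler_norm (s - r); rewrite [`|s - r|]distrC.
do !case: ifPn; rewrite -?ltNge => *;
  rewrite ler_norml; apply/andP; split; lra.
Qed.
End contract_interval.

(** * Atomless Stieltjes measures on the real line *)

Section cumulative_measure.
Context {R : realType} (F : cumulative R R).
Context (F_cont : continuous F).

Lemma exists_stieltjes_measure :
  exists mu : {measure set R -> \bar R},
    (forall x y, x <= y -> mu `]x, y]%classic = (F y - F x)%:E) /\
    forall x, mu [set x] = 0%E.
Proof.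
pose mu' : {measure set (measurableTypeR R) -> \bar R} :=
  lebesgue_stieltjes_measure F.
pose mu0 : set R -> \bar R := mu'.
(* The same set function, repackaged as a measure on [R] itself instead of [measurableTypeR R]. *)
pose mu : {measure set R -> \bar R} := HB.pack mu0
  (@isMeasure.Build _ R R mu0 (measure0 mu') (measure_ge0 mu')
    (@measure_semi_sigma_additive _ _ _ mu')).
have mu_itv x y : x <= y -> mu `]x, y]%classic = (F y - F x)%:E.
  move=> xy; transitivity (lebesgue_stieltjes_measure F `]x, y]%classic) => //.
  rewrite /lebesgue_stieltjes_measure /measure_extension/=.
  by rewrite measurable_mu_extE/= ?wlength_itv_bnd//; exact: is_ocitv.
exists mu; split => // x; apply/eqP; rewrite eq_le measure_ge0 andbT.
(* Continuity excludes atoms: [x] lies in []x - d / 2, x]], whose measure is at most [e]. *)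
apply/lee_addgt0Pr => e e0; rewrite add0e.
have /cvgrPdist_lt/(_ e e0)/nbhs_ballP[d /= d0 dF] := @F_cont x.
have d2 : 0 < d / 2 by rewrite divr_gt0.
have xd : x - d / 2 <= x by rewrite lerBlDr lerDl ltW.
have /ltW Fd : `|F x - F (x - d / 2)| < e.
  by apply: dF; rewrite /ball/= opprB addrC subrK gtr0_norm//; lra.
apply: (@le_trans _ _ (mu `]x - d / 2, x]%classic)).
  apply: le_measure; rewrite ?inE//.
  by move=> _ ->; rewrite /= in_itv/= lexx andbT; lra.
by rewrite mu_itv// lee_fin (le_trans (ler_norm _)).
Qed.

End cumulative_measure.

(** * Stieltjes charges, first for monotone functions, then for bounded variation *)

Section exists_stieltjes.
Context {R : realType} (a b : \bar R).
Context (ab : (a < b)%E).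
Implicit Types f g : \bar R -> R.

(** Take the Stieltjes measure of the clamped function on [R], restrict it to the image of []a, b]]
    under [contract], and push it forward by [expand]. *)
Lemma exists_stieltjes_nondecreasing f : nondecreasing_on a b f ->
  {within `[a, b], continuous f} -> exists nu, is_stieltjes a b f nu.
Proof.
move=> fnd cf.
have Fc := clamped_continuous ab cf.
pose F : cumulative R R := HB.pack (clamped a b f)
  (isCumulative.Build R _ R (clamped a b f)
    (clamped_nondecreasing ab fnd) (right_continuousW Fc)).
have [mu [mu_itv mu1]] := @exists_stieltjes_measure _ F Fc.
(* On [D] the map [expand] has inverse [contract], so preimages of points and intervals can be
   computed; the restriction also makes the measure finite. *)
pose D : set R := `]contract a, contract b]%classic.
have mD : measurable D by exact: measurable_itv.
have mX A : measurable A -> measurable (@expand R @^-1` A).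
  by move=> mA; rewrite -[X in measurable X]setTI; exact: measurable_expand.
pose muD : {measure set R -> \bar R} := mrestr mu mD.
have muDE A : muD A = mu (A `&` D) by [].
pose nuf (A : set (\bar R)) : \bar R := muD (@expand R @^-1` A).
have nu0 : nuf set0 = 0%E by rewrite /nuf preimage_set0 measure0.
have nufin A : measurable A -> nuf A \is a fin_num.
  move=> mA; rewrite ge0_fin_numE ?measure_ge0//.
  apply: (@le_lt_trans _ _ (mu D)).
    by rewrite /nuf muDE le_measure ?inE//; apply: measurableI => //; exact: mX.
  by rewrite mu_itv ?ltry// le_contract ltW.
have nusig : semi_sigma_additive nuf.
  move=> A mA tA mUA; rewrite /nuf preimage_bigcup.
  apply: measure_semi_sigma_additive.
  - by move=> n; exact: mX.
  - apply/trivIsetP => i j _ _ ij; rewrite -preimage_setI.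
    by move/trivIsetP : tA => /(_ _ _ _ _ ij) ->//; rewrite preimage_set0.
  - by rewrite -preimage_bigcup; exact: mX.
pose nu : {charge set (\bar R) -> \bar R} :=
  HB.pack nuf (isCharge.Build _ _ _ nuf nu0 nufin nusig).
have nuE A : nu A = mu (@expand R @^-1` A `&` D) by [].
have expandD r : D r -> contract (expand r) = r.
  by rewrite /D /= in_itv/= => /andP[/ltW ar rb];
    apply: (contract_expand_in (a := a) (b := b)); rewrite ar.
exists nu; split=> [A mA|x|x y ax xy yb].
- rewrite !nuE; congr (mu _); apply/seteqP; split => r [].
    move=> Ar Dr; split => //; split => //=; rewrite in_itv/=.
    rewrite -!le_contract expandD//; move: Dr; rewrite /D/= in_itv/=.
    by move=> /andP[/ltW -> ->].
  by move=> [].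
- rewrite nuE.
  apply/eqP; rewrite eq_le measure_ge0 andbT -(mu1 (contract x)).
  apply: le_measure; rewrite ?inE//.
    by apply: measurableI => //; exact: mX.
  by move=> r [<-] Dr /=; rewrite expandD.
- rewrite nuE -(@clampedE _ a b f x) ?ax ?(le_trans xy)//.
  rewrite -(@clampedE _ a b f y) ?yb ?(le_trans ax)//.
  rewrite -mu_itv ?le_contract//; congr (mu _); apply/seteqP; split => r.
    move=> [/=] + Dr; rewrite !in_itv/= => /andP[xr ry].
    by move: xr ry; rewrite -lt_contract -le_contract expandD// => -> ->.
  move=> /=; rewrite !in_itv/= => /andP[xr ry].
  have Dr : D r.
    rewrite /D/= in_itv/= (le_lt_trans _ xr) ?le_contract//=.
    by rewrite (le_trans ry) ?le_contract.
  by split => //; rewrite -lt_contract -le_contract expandD// xr.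
Qed.

Lemma is_stieltjesB f g nu1 nu2 : is_stieltjes a b f nu1 ->
  is_stieltjes a b g nu2 ->
  exists nu, is_stieltjes a b (fun x => f x - g x) nu.
Proof.
move=> [f1 f2 f3] [g1 g2 g3].
have [nu nuE] : exists nu : {charge set (\bar R) -> \bar R},
    forall A, nu A = (nu1 A - nu2 A)%E by exists (cadd nu1 (copp nu2)).
exists nu; split=> [A mA|x|x y ax xy yb].
- by rewrite !nuE f1// g1.
- by rewrite nuE f2 g2 sube0.
- by rewrite nuE f3// g3// -EFinB; congr EFin; ring.
Qed.

(** [expand] carries a partition of the contracted interval to a partition of [[a, b]] with the same
    sum of increments. *)
Lemma ebounded_variation_clamped f : ebounded_variation a b f ->
  bounded_variation (contract a) (contract b) (clamped a b f).
Proof.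
move=> [M Mf]; exists M => _ [s sP <-].
pose u := contract a :: s.
have uP n : (n < (size s).+1)%N ->
    contract a <= nth (contract b) u n <= contract b.
  by move=> ns; rewrite itv_partition_nth_ge//= itv_partition_nth_le.
(* The default values [b] and [contract b] correspond under [expand], so the identity holds at every
   index, even beyond the list. *)
have nthE n :
    nth b (a :: map (@expand R) s) n = expand (nth (contract b) u n).
  have nth_expand (v : seq R) :
      nth b (map (@expand R) v) n = expand (nth (contract b) v n).
    by elim: v n => [|x v IH] [|m]//=; rewrite contractK.
  by rewrite -nth_expand /= contractK.
have tP : itv_partition a b (map (@expand R) s).
  have [sp /eqP sl] := sP; split; last first.
    by rewrite -{1}[a]contractK last_map sl contractK.
  apply/(pathP b) => n; rewrite size_map => ns.
  have -> : nth b (map (@expand R) s) n = expand (nth (contract b) u n.+1).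
    by rewrite -nthE.
  rewrite nthE -lt_contract !(contract_expand_in (a := a) (b := b)).
  - by move/(pathP (contract b)) : sp; exact.
  - exact: uP.
  - by apply: uP; exact: ltnW.
have := Mf _ (ex_intro2 _ _ _ tP erefl); apply: le_trans.
rewrite size_map /variation big_nat [X in _ <= X]big_nat.
rewrite le_eqVlt; apply/orP; left; apply/eqP; apply: eq_bigr => n /= ns.
have clE m : (m < (size s).+1)%N -> clamped a b f (nth (contract b) u m) =
    f (nth b (a :: map (@expand R) s) m).
  move=> ms; rewrite nthE -(@clampedE _ a b f (expand _)); last exact/expand_in/uP.
  by rewrite (contract_expand_in (uP _ ms)).
by have /= -> := clE n.+1 ns; have /= -> := clE n (ltnW ns).
Qed.

Lemma variation_controlled_ebounded f : variation_controlled a b f ->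
  ebounded_variation a b f.
Proof.
move=> [tau tau_nd ftau]; exists (tau b - tau a) => _ [s sP <-].
pose t n := tau (nth b (a :: s) n).
have -> : tau b - tau a = t (size s) - t 0.
  by rewrite /t (itv_partition_nth_size _ sP).
rewrite -telescope_sumr// big_nat [X in _ <= X]big_nat.
apply: ler_sum => n /= ns; apply: ftau.
- by apply: itv_partition_nth_ge => //; exact: ltnW.
- by have [/(pathP b)/(_ n ns)/ltW] := sP.
- exact: (@itv_partition_nth_le _ _ a b s n.+1 ns sP).
Qed.

(** Jordan decomposition: with [V] the variation function, [f] is the difference of the
    nondecreasing functions [V] and [V - f]. Both are continuous because the total variation of a
    continuous function of bounded variation is. *)
Lemma exists_stieltjes_BV f : continuous_BV a b f ->
  exists nu, is_stieltjes a b f nu.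
Proof.
move=> [cf /ebounded_variation_clamped bvF].
set F := clamped a b f in bvF.
have alphabeta : contract a < contract b by rewrite lt_contract.
have cF : {within `[contract a, contract b], continuous F}.
  by apply: continuous_subspaceT; exact: clamped_continuous.
have cV := total_variation_continuous alphabeta cF bvF.
pose V (x : \bar R) := fine (total_variation (contract a) (contract x) F).
have finTV r : contract a <= r -> r <= contract b ->
    total_variation (contract a) r F \is a fin_num.
  by move=> ar rb; apply/(bounded_variationP _ ar)/(bounded_variationl ar rb).
have VD x y : (a <= x)%E -> (x <= y)%E -> (y <= b)%E ->
    `|f y - f x| <= V y - V x.
  move=> ax xy yb.
  have cax : contract a <= contract x by rewrite le_contract.
  have cxy : contract x <= contract y by rewrite le_contract.
  have cyb : contract y <= contract b by rewrite le_contract.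
  have := total_variation_ge F cxy.
  have := total_variationD F cax cxy; rewrite /V => ->.
  have finx := finTV _ cax (le_trans cxy cyb).
  have finxy : total_variation (contract x) (contract y) F \is a fin_num.
    apply/(bounded_variationP _ cxy).
    exact/(bounded_variationl cxy cyb)/(bounded_variationr cax (le_trans cxy cyb)).
  rewrite fineD// addrAC subrr add0r -lee_fin fineK//.
  by rewrite /F !clampedE// ?ax ?yb ?(le_trans ax) ?(le_trans xy).
have V_nd : nondecreasing_on a b V.
  by move=> x y ax xy yb; rewrite -subr_ge0 (le_trans _ (VD _ _ ax xy yb)).
have V_cont : {within `[a, b], continuous V}.
  apply/within_continuousP => x xab e e0.
  have := xab; rewrite /= in_itv/= => /(contract_in) cxab.
  move/within_continuousP : cV => /(_ (contract x)).
  rewrite /= in_itv/= => /(_ cxab e e0)/nbhs_ballP[d /= d0 dV].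
  apply/nbhs_ballP; exists d => // y xy yab; apply: dV => //.
  by rewrite in_itv/=; apply: contract_in; move: yab; rewrite /= in_itv.
have [nu1 nu1V] := exists_stieltjes_nondecreasing V_nd V_cont.
have [|nu2 nu2V] := @exists_stieltjes_nondecreasing (fun x => V x - f x) _
  (within_continuousB V_cont cf).
  move=> x y ax xy yb; have := VD x y ax xy yb.
  by rewrite ler_norml => /andP[? ?]; lra.
have [nu nuB] := is_stieltjesB nu1V nu2V.
exists nu; move: nuB; congr is_stieltjes.
by apply/funext => x; ring.
Qed.

End exists_stieltjes.

(** * Luckock's equation *)

Lemma within_continuousV {T : topologicalType} {R : realType} (A : set T)
    (f : T -> R) : (forall x, A x -> f x != 0) ->
  {within A, continuous f} -> {within A, continuous (fun x => 1 / f x)}.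
Proof.
move=> f0 cf; suff : {within A, continuous (fun x => (f x)^-1)}.
  by under [in X in _ -> X]eq_fun do rewrite div1r.
apply/within_continuousP => x Ax e e0.
have : (fun y => (f y)^-1) @ (x : subspace A) --> (f x)^-1.
  exact: cvgV (f0 x Ax) (cf x).
move=> /cvgrPdist_lt/(_ e e0).
by rewrite /nbhs/= -nbhs_subspace_in.
Qed.

Section stieltjes_BV.
Context {R : realType} (a b : \bar R).
Context (ab : (a < b)%E).

Lemma stieltjesP f : continuous_BV a b f ->
  is_stieltjes a b f (stieltjes a b f).
Proof.
move=> /(exists_stieltjes_BV ab) h; rewrite /stieltjes.
by case: pselect => // h'; exact: (svalP (cid h')).
Qed.

Lemma continuous_BVP f : continuous_BV a b f <->
  {within `[a, b], continuous f} /\ variation_controlled a b f.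
Proof.
split=> [cbvf|[cf /variation_controlled_ebounded]//].
by split; [exact: cbvf.1|exact: stieltjes_variation_controlled (stieltjesP cbvf)].
Qed.

(** [J x] is the integral over []a, x]]. The listed properties are all that is used of it later, so
    that the remaining argument is pure calculus with two-point functions; the absence of an atom at
    [a] allows the closed interval at the end. *)
Lemma stieltjes_primitive f g : continuous_BV a b f -> continuous_BV a b g ->
  exists J : \bar R -> R,
  [/\ {within `[a, b], continuous J}, variation_controlled a b J,
      infinitesimal a b (fun x y => J y - J x - g x * (f y - f x)),
      J a = 0 & charge_integral (stieltjes a b f) `[a, b]%classic g = J b].
Proof.
move=> bf /continuous_BVP[cg vg].
have sf := stieltjesP bf.
exists (fun x => charge_integral (stieltjes a b f) `]a, x]%classic g).
have Jinf : infinitesimal a b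
    (fun x y => charge_integral (stieltjes a b f) `]a, y]%classic g
      - charge_integral (stieltjes a b f) `]a, x]%classic g
      - g x * (f y - f x)).
  apply: eq_infinitesimal (charge_integral_infinitesimal sf cg).
  by move=> x y ax xy yb; rewrite (charge_integral_itvD _ cg vg ax xy yb).
split.
- exact: continuous_infinitesimal Jinf vg bf.1.
- exact: charge_integral_variation_controlled.
- exact: Jinf.
- by rewrite set_itvoc0 /charge_integral !Rintegral_set0 subrr.
- exact: charge_integral_segment sf cg vg (ltW ab).
Qed.

End stieltjes_BV.

(** Convertible with the functions integrated in [Lambda_minus] and [Lambda_plus]. *)
Definition recip {T : Type} {R : realType} (f : T -> R) x := 1 / f x.

Section luckock.
Context {R : realType} (a b : \bar R) (lm lp : \bar R -> R).
Context (ab : (a < b)%E)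
  (lm_cont : {within `[a, b], continuous lm})
  (lp_cont : {within `[a, b], continuous lp})
  (lm_nonincr : forall x y, (a <= x)%E -> (x <= y)%E -> (y <= b)%E ->
     lm y <= lm x)
  (lp_nondecr : forall x y, (a <= x)%E -> (x <= y)%E -> (y <= b)%E ->
     lp x <= lp y)
  (lp_a_gt0 : 0 < lp a)
  (lm_b_gt0 : 0 < lm b).

Local Notation im := (recip lm).
Local Notation ip := (recip lp).

Let lm_gt0 x : (a <= x)%E -> (x <= b)%E -> 0 < lm x.
Proof. by move=> ax xb; rewrite (lt_le_trans lm_b_gt0)// lm_nonincr. Qed.

Let lp_gt0 x : (a <= x)%E -> (x <= b)%E -> 0 < lp x.
Proof. by move=> ax xb; rewrite (lt_le_trans lp_a_gt0)// lp_nondecr. Qed.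

Let neq0 x : (a <= x)%E -> (x <= b)%E -> (lm x != 0) * (lp x != 0).
Proof. by move=> ax xb; rewrite !gt_eqF ?lm_gt0 ?lp_gt0. Qed.

Let im_cont : {within `[a, b], continuous im}.
Proof.
apply: (within_continuousV _ lm_cont) => x /=; rewrite in_itv/= => /andP[ax xb].
by rewrite gt_eqF ?lm_gt0.
Qed.

Let ip_cont : {within `[a, b], continuous ip}.
Proof.
apply: (within_continuousV _ lp_cont) => x /=; rewrite in_itv/= => /andP[ax xb].
by rewrite gt_eqF ?lp_gt0.
Qed.

Let im_nondecr : nondecreasing_on a b im.
Proof.
move=> x y ax xy yb; rewrite /recip !div1r.
have xb := le_trans xy yb; have ay := le_trans ax xy.
by rewrite lef_pV2 ?posrE; [exact: lm_nonincr|exact: lm_gt0|exact: lm_gt0].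
Qed.

Let ip_nonincr x y : (a <= x)%E -> (x <= y)%E -> (y <= b)%E -> ip y <= ip x.
Proof.
move=> ax xy yb; rewrite /recip !div1r.
have xb := le_trans xy yb; have ay := le_trans ax xy.
by rewrite lef_pV2 ?posrE; [exact: lp_nondecr|exact: lp_gt0|exact: lp_gt0].
Qed.

Let vim : variation_controlled a b im.
Proof. exact: variation_controlled_nondecreasing. Qed.

Let vlp : variation_controlled a b lp.
Proof. exact: variation_controlled_nondecreasing. Qed.

Let variation_controlled_nonincr f :
  (forall x y, (a <= x)%E -> (x <= y)%E -> (y <= b)%E -> f y <= f x) ->
  variation_controlled a b f.
Proof.
move=> f_ni; have : variation_controlled a b (fun x => 0 - f x).
  apply: variation_controlled_nondecreasing => x y ax xy yb.
  by rewrite !sub0r lerN2 f_ni.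
move=> /(variation_controlledB (variation_controlled_cst a b 0)).
by under eq_fun do rewrite !sub0r opprK.
Qed.

Let vlm : variation_controlled a b lm.
Proof. exact: variation_controlled_nonincr. Qed.

Let vip : variation_controlled a b ip.
Proof. exact: variation_controlled_nonincr. Qed.

Lemma luckock_solutionP fm fp : luckock_solution a b lm lp fm fp <->
  [/\ continuous_BV a b fm /\ continuous_BV a b fp,
      infinitesimal a b
        (fun x y => fm x * (lp y - lp x) + lm x * (fp y - fp x)),
      infinitesimal a b
        (fun x y => fp x * (lm y - lm x) + lp x * (fm y - fm x))
    & fm b = 1 /\ fp a = 1].
Proof.
have slp : is_stieltjes a b lp (stieltjes a b lp).
  by apply: stieltjesP => //; exact/continuous_BVP.
have slm : is_stieltjes a b lm (stieltjes a b lm).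
  by apply: stieltjesP => //; exact/continuous_BVP.
split=> -[[bm bp] e1 e2 e3]; have [cm vm] := (continuous_BVP ab fm).1 bm;
  have [cp vp] := (continuous_BVP ab fp).1 bp; split=> //.
- exact/(density_equationP (ltW ab) slp (stieltjesP ab bp)).
- exact/(density_equationP (ltW ab) slm (stieltjesP ab bm)).
- exact/(density_equationP (ltW ab) slp (stieltjesP ab bp)).
- exact/(density_equationP (ltW ab) slm (stieltjesP ab bm)).
Qed.

Lemma recip_lm_BV : continuous_BV a b im. Proof. exact/continuous_BVP. Qed.

Lemma recip_lp_BV : continuous_BV a b ip. Proof. exact/continuous_BVP. Qed.

(** * The explicit solution, for a given primitive [J] of [1/lp d(1/lm)] *)

Section solution.
Context (J : \bar R -> R).
Context (J_cont : {within `[a, b], continuous J})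
  (vJ : variation_controlled a b J)
  (J_inf : infinitesimal a b (fun x y => J y - J x - ip x * (im y - im x)))
  (J_a : J a = 0).

Let im_gt0 x : (a <= x)%E -> (x <= b)%E -> 0 < im x.
Proof. by move=> ax xb; rewrite /recip div1r invr_gt0 lm_gt0. Qed.

Let ip_gt0 x : (a <= x)%E -> (x <= b)%E -> 0 < ip x.
Proof. by move=> ax xb; rewrite /recip div1r invr_gt0 lp_gt0. Qed.

(** The integrand is positive and the integrator nondecreasing. This makes the denominator of
    [sol_const] positive. *)
Lemma primitive_ge0 : 0 <= J b.
Proof.
rewrite -J_a; apply: (infinitesimal_ge (ltW ab) J_inf) => x y ax xy yb.
rewrite lerBlDr lerDl mulr_ge0//; first by rewrite ltW ?ip_gt0// (le_trans xy).
by rewrite subr_ge0 im_nondecr.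
Qed.

(* [J] and [J'] are the indefinite integrals of [1/lp d(1/lm)] and
   [1/lm d(1/lp)]. *)
Lemma primitive_by_parts J' :
  infinitesimal a b (fun x y => J' y - J' x - im x * (ip y - ip x)) ->
  J' a = 0 -> J b + J' b = im b * ip b - im a * ip a.
Proof.
move=> J'_inf J'_a.
suff : J a + J' a - im a * ip a = J b + J' b - im b * ip b.
  by rewrite J_a J'_a; lra.
apply: (@infinitesimal_increments_eq _ a b
  (fun x => J x + J' x - im x * ip x)) => //; last exact: ltW.
have := infinitesimalB (infinitesimalD J_inf J'_inf)
  (infinitesimal_cross vim ip_cont).
by apply: eq_infinitesimal => x y _ _ _; ring.
Qed.

(* [sol_const] is the constant [K = f_- lambda_+ + f_+ lambda_-], and [sol_ratio]
   the function [f_- / lambda_-]. *)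
Definition sol_const := (im b + ip a) / (im a * ip a + J b).
Local Notation K := sol_const.
Definition sol_ratio x := im b - K * (J b - J x).
Local Notation H := sol_ratio.
Definition sol_minus x := lm x * H x.
(** Obtained by solving [fm x * lp x + fp x * lm x = K] for [fp x]. *)
Definition sol_plus x := K * im x - lp x * H x.
Local Notation fm := sol_minus.
Local Notation fp := sol_plus.

Let denom_gt0 : 0 < im a * ip a + J b.
Proof.
apply: ltr_pwDl; last exact: primitive_ge0.
by apply: mulr_gt0; [apply: im_gt0|apply: ip_gt0] => //; exact: ltW.
Qed.

(** This is the boundary condition [fp a = 1], multiplied by [ip a]. *)
Let KE : K * (im a * ip a + J b) = im b + ip a.
Proof. by rewrite /sol_const divfK//; exact: lt0r_neq0 denom_gt0. Qed.

Let H_cont : {within `[a, b], continuous H}.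
Proof.
apply: within_continuousB; first exact: within_continuous_cst.
apply: within_continuousM; first exact: within_continuous_cst.
by apply: within_continuousB J_cont; exact: within_continuous_cst.
Qed.

Let vH : variation_controlled a b H.
Proof.
apply: variation_controlledB; first exact: variation_controlled_cst.
apply: variation_controlledM; first exact: variation_controlled_cst.
by apply: variation_controlledB vJ; exact: variation_controlled_cst.
Qed.

Let lmim x : (a <= x)%E -> (x <= b)%E -> lm x * im x = 1.
Proof. by move=> ax xb; rewrite /recip div1r divff// neq0. Qed.

Let lpip x : (a <= x)%E -> (x <= b)%E -> lp x * ip x = 1.
Proof. by move=> ax xb; rewrite /recip div1r divff// neq0. Qed.

Lemma luckock_solution_exists : luckock_solution a b lm lp fm fp.
Proof.
apply/luckock_solutionP; split.
- split; apply/continuous_BVP => //; split.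
  + exact: within_continuousM.
  + exact: variation_controlledM.
  + apply: within_continuousB; last exact: within_continuousM.
    by apply: within_continuousM im_cont; exact: within_continuous_cst.
  + apply: variation_controlledB; last exact: variation_controlledM.
    by apply: variation_controlledM vim; exact: variation_controlled_cst.
(* By the product rule the first equation is [- K * lm * lp] times the defining relation of [J],
   minus [lm] times the cross term of [H] and [lp]. *)
- have vh : variation_controlled a b (fun x => - K * (lm x * lp x)).
    apply: variation_controlledM; first exact: variation_controlled_cst.
    exact: variation_controlledM.
  have := infinitesimalB (infinitesimalMl vh J_inf)
    (infinitesimalMl vlm (infinitesimal_cross vH lp_cont)).
  apply: eq_infinitesimal => x y ax xy yb.
  have e := lpip ax (le_trans xy yb).
  rewrite /sol_minus /sol_plus /sol_ratio.
  have -> : - K * (lm x * lp x) * (J y - J x - ip x * (im y - im x)) =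
    - K * lm x * (lp x * (J y - J x) - (lp x * ip x) * (im y - im x)) by ring.
  rewrite e; ring.
(* Similarly for the second equation; here [lm * im = 1] produces a further cross term, of [lm] and
   [im], with coefficient [K]. *)
- have vh : variation_controlled a b (fun x => K * (lm x * lp x)).
    apply: variation_controlledM; first exact: variation_controlled_cst.
    exact: variation_controlledM.
  have := infinitesimalB (infinitesimalD (infinitesimalMl vh J_inf)
    (infinitesimalMl vlp (infinitesimal_cross vH lm_cont)))
    (infinitesimalZ K (infinitesimal_cross vim lm_cont)).
  apply: eq_infinitesimal => x y ax xy yb.
  have e1 := lpip ax (le_trans xy yb).
  have e2 := lmim ax (le_trans xy yb).
  have e3 := lmim (le_trans ax xy) yb.
  rewrite /sol_minus /sol_plus /sol_ratio.
  have -> : K * (lm x * lp x) * (J y - J x - ip x * (im y - im x)) =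
    K * lm x * (lp x * (J y - J x) - (lp x * ip x) * (im y - im x)) by ring.
  have -> : K * ((lm y - lm x) * (im y - im x)) =
    K * (lm y * im y - lm x * im y - lm y * im x + lm x * im x) by ring.
  rewrite e1 e2 e3.
  have -> : K * lm x * (lp x * (J y - J x) - 1 * (im y - im x)) =
    K * (lm x * lp x * (J y - J x) - lm x * im y + lm x * im x) by ring.
  rewrite e2.
  have -> : (K * im x - lp x * (im b - K * (J b - J x))) * (lm y - lm x) =
    K * (lm y * im x - lm x * im x) - lp x * (im b - K * (J b - J x)) * (lm y - lm x)
    by ring.
  rewrite e2; ring.
- have bb := lmim (ltW ab) (lexx b); have aa := lpip (lexx a) (ltW ab).
  rewrite /sol_minus /sol_plus /sol_ratio subrr mulr0 subr0 bb J_a subr0; split=> //.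
  have -> : K * im a - lp a * (im b - K * J b) =
    lp a * ip a * K * im a - lp a * im b + lp a * K * J b.
    by rewrite aa; ring.
  have -> : lp a * ip a * K * im a - lp a * im b + lp a * K * J b =
    lp a * (K * (im a * ip a + J b)) - lp a * im b by ring.
  by rewrite KE mulrDr aa; ring.
Qed.

(** [C] and [D] are constant for every solution. The boundary values force [C a = K], after which
    [D] determines [gm], and [C] determines [gp]. *)
Lemma luckock_solution_unique gm gp : luckock_solution a b lm lp gm gp ->
  forall x, (a <= x <= b)%E -> gm x = fm x /\ gp x = fp x.
Proof.
move=> /luckock_solutionP[[bm bp] e1 e2 [gmb gpa]] z /andP[az zb].
have [[cm vm] [cp vp]] :=
  ((continuous_BVP ab gm).1 bm, (continuous_BVP ab gp).1 bp).
pose C x := gm x * lp x + gp x * lm x.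
have C_cst x : (a <= x)%E -> (x <= b)%E -> C x = C a.
  move=> ax xb; apply/esym/(@infinitesimal_increments_eq _ a b) => //.
  have := infinitesimalD (infinitesimalD e1 e2)
    (infinitesimalD (infinitesimal_cross vm lp_cont)
       (infinitesimal_cross vp lm_cont)).
  by apply: eq_infinitesimal => u v _ _ _; rewrite /C; ring.
pose D x := gm x * im x - C a * J x.
have D_cst x : (a <= x)%E -> (x <= b)%E -> D x = D b.
  move=> ax xb; apply: (@infinitesimal_increments_eq _ a b) => //.
  (* Dividing the second equation by [lm * lp] expresses [im dgm] as [- gp * ip * im dlm]. Since
     [lm * im = 1], [im dlm] is [- lm dim] up to a cross term, and so [d(gm * im)] is [C * ip dim],
     that is [C dJ]. *)
  have vh1 := variation_controlledM vim vip.
  have vh2 := variation_controlledM vp vip.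
  have := infinitesimalD
    (infinitesimalB (infinitesimalMl vh1 e2) (infinitesimalZ (C a) J_inf))
    (infinitesimalD (infinitesimal_cross vim cm)
       (infinitesimalMl vh2 (infinitesimal_cross vim lm_cont))).
  apply: eq_infinitesimal => u v au uv vb.
  have ub := le_trans uv vb; have av := le_trans au uv.
  rewrite /D -(C_cst u au ub) /C /recip.
  have [[? ?] [? ?]] := (neq0 au ub, neq0 av vb).
  by field; repeat (apply/andP; split).
have imb := lmim (ltW ab) (lexx b); have ima := lmim (lexx a) (ltW ab).
have ipa := lpip (lexx a) (ltW ab).
have Db : D b = im b - C a * J b by rewrite /D gmb mul1r.
(* Substituting [D a = D b] into [C a * ip a * im a] shows that [C a] satisfies the linear equation
   [KE], whose coefficient is positive. *)
have CaK : C a = K.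
  have := D_cst a (lexx a) (ltW ab); rewrite Db /D J_a mulr0 subr0 => Da.
  have Ca : C a * ip a * im a = gm a * im a + ip a.
    have -> : gm a * im a + ip a =
      gm a * im a * (lp a * ip a) + (lm a * im a) * ip a.
      by rewrite ipa ima; ring.
    by rewrite /C gpa; ring.
  rewrite Da in Ca.
  by apply: (mulIf (lt0r_neq0 denom_gt0)); rewrite KE; lra.
have gmz : gm z * im z = H z.
  have := D_cst z az zb; rewrite Db /D /sol_ratio CaK; lra.
have imz := lmim az zb.
have gmE : gm z = fm z by rewrite /sol_minus -gmz mulrCA imz mulr1.
split=> //.
have Cz := C_cst z az zb; rewrite CaK /C gmE /sol_minus in Cz.
have -> : gp z = gp z * (lm z * im z) by rewrite imz mulr1.
have -> : gp z * (lm z * im z) = (gp z * lm z) * im z by ring.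
have -> : gp z * lm z = K - lm z * H z * lp z by lra.
have -> : (K - lm z * H z * lp z) * im z = K * im z - lp z * H z * (lm z * im z).
  by ring.
by rewrite imz mulr1 /sol_plus.
Qed.

(** The last factor is [Lambda_minus] once [J b] is identified with its integral. *)
Lemma sol_minus_a : fm a =
  lm a * ip a / (im a * ip a + J b) * (im a * im b - J b).
Proof.
have D0 := lt0r_neq0 denom_gt0.
rewrite /sol_minus /sol_ratio J_a subr0 /sol_const.
by field; exact: D0.
Qed.

(** By [primitive_by_parts] the inner parenthesis is the integral of [1/lm d(1/lp)], so the last
    factor is [Lambda_plus]. *)
Lemma sol_plus_b : fp b = lp b * im b / (im a * ip a + J b)
  * (ip a * ip b + (im b * ip b - im a * ip a - J b)).
Proof.
have D0 := lt0r_neq0 denom_gt0.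
have lpb0 : lp b != 0 by rewrite neq0// ltW.
rewrite /sol_plus /sol_ratio subrr mulr0 subr0 /sol_const [recip lp b]/recip.
by field; rewrite lpb0 D0.
Qed.

(** The function [fm * lp + fp * lm] takes the same value [K] at both end points. *)
Lemma sol_balance : lp b - fm a * lp a = lm a - fp b * lm b.
Proof.
have cst x : (a <= x)%E -> (x <= b)%E -> fm x * lp x + fp x * lm x = K.
  move=> ax xb; have e := lmim ax xb.
  have -> : fm x * lp x + fp x * lm x = K * (lm x * im x).
    by rewrite /sol_minus /sol_plus; ring.
  by rewrite e mulr1.
have /luckock_solutionP[_ _ _ [fmb fpa]] := luckock_solution_exists.
have := cst a (lexx a) (ltW ab); have := cst b (ltW ab) (lexx b).
rewrite fmb fpa; lra.
Qed.

Lemma sol_minus_coef_gt0 : 0 < lm a * ip a / (im a * ip a + J b).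
Proof.
apply: divr_gt0 denom_gt0; apply: mulr_gt0; first exact: lm_gt0 (ltW ab).
by apply: ip_gt0 => //; exact: ltW.
Qed.

Lemma sol_plus_coef_gt0 : 0 < lp b * im b / (im a * ip a + J b).
Proof.
apply: divr_gt0 denom_gt0; apply: mulr_gt0; first exact: lp_gt0 (ltW ab) _.
by apply: im_gt0 => //; exact: ltW.
Qed.

End solution.
End luckock.

Unset Implicit Arguments.

Theorem proposition2 (R : realType) (a b : \bar R) (lm lp : \bar R -> R)
  (ab : (a < b)%E)
  (lm_ge0 : forall x, (a <= x <= b)%E -> 0 <= lm x)
  (lp_ge0 : forall x, (a <= x <= b)%E -> 0 <= lp x)
  (lm_cont : {within `[a, b], continuous lm})
  (lp_cont : {within `[a, b], continuous lp})
  (lm_nonincr : forall x y, (a <= x)%E -> (x <= y)%E -> (y <= b)%E ->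
     lm y <= lm x)
  (lp_nondecr : forall x y, (a <= x)%E -> (x <= y)%E -> (y <= b)%E ->
     lp x <= lp y)
  (lp_a_gt0 : 0 < lp a)
  (lm_b_gt0 : 0 < lm b) :
  exists fm fp : \bar R -> R,
    luckock_solution a b lm lp fm fp /\
    (forall gm gp : \bar R -> R, luckock_solution a b lm lp gm gp ->
       forall x, (a <= x <= b)%E -> gm x = fm x /\ gp x = fp x) /\
    (0 <= fm a <-> 0 <= Lambda_minus a b lm lp) /\
    (0 <= fp b <-> 0 <= Lambda_plus a b lm lp) /\
    (fm a <= 0 <-> Lambda_minus a b lm lp <= 0) /\
    (fp b <= 0 <-> Lambda_plus a b lm lp <= 0) /\
    lp b - fm a * lp a = lm a - fp b * lm b.
Proof.
have bim := recip_lm_BV ab lm_cont lm_nonincr lm_b_gt0.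
have bip := recip_lp_BV ab lp_cont lp_nondecr lp_a_gt0.
have [J [J_cont vJ J_inf J_a J_b]] := stieltjes_primitive ab bim bip.
have [J' [_ _ J'_inf J'_a J'_b]] := stieltjes_primitive ab bip bim.
(* Integration by parts expresses the integral in [Lambda_plus] through [J b], the only integral in
   the explicit solution. *)
have JJ' := primitive_by_parts ab lp_cont lm_nonincr lp_nondecr lp_a_gt0 lm_b_gt0
  J_inf J_a J'_inf J'_a.
have Lm : Lambda_minus a b lm lp = recip lm a * recip lm b - J b.
  by rewrite -J_b /recip mulf_div mulr1.
have Lp : Lambda_plus a b lm lp = recip lp a * recip lp b
    + (recip lm b * recip lp b - recip lm a * recip lp a - J b).
  have -> : recip lm b * recip lp b - recip lm a * recip lp a - J b = J' b by lra.
  by rewrite -J'_b /recip mulf_div mulr1.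
exists (sol_minus a b lm lp J), (sol_plus a b lm lp J).
split; first exact: luckock_solution_exists.
split; first exact: luckock_solution_unique.
have cm : 0 < lm a * recip lp a / (recip lm a * recip lp a + J b).
  exact: sol_minus_coef_gt0.
have cp : 0 < lp b * recip lm b / (recip lm a * recip lp a + J b).
  exact: sol_plus_coef_gt0.
have bal := sol_balance ab lm_cont lp_cont lm_nonincr lp_nondecr lp_a_gt0
  lm_b_gt0 J_cont vJ J_inf J_a.
have fma : sol_minus a b lm lp J a = lm a * recip lp a /
    (recip lm a * recip lp a + J b) * Lambda_minus a b lm lp.
  by rewrite Lm; exact: sol_minus_a.
have fpb : sol_plus a b lm lp J b = lp b * recip lm b /
    (recip lm a * recip lp a + J b) * Lambda_plus a b lm lp.
  by rewrite Lp; exact: sol_plus_b.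
(* [bal] makes the last conjunct an identity; the sign equivalences hold because [cm] and [cp] make
   the coefficients positive. *)
rewrite bal; split; first by rewrite fma pmulr_rge0.
split; first by rewrite fpb pmulr_rge0.
split; first by rewrite fma pmulr_rle0.
by split; first by rewrite fpb pmulr_rle0.
Qed.
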